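(* Let $0\leq L<\infty$, let $I$ be a finite nonempty index set, and let $A_I=\{(x_i,y_i,g^x_i,g^y_i,f_i)\}_{i\in I}$ with $x_i,g^x_i\in\mathbb{R}^{d_x}$, $y_i,g^y_i\in\mathbb{R}^{d_y}$, $f_i\in\mathbb{R}$. Let $X,Y,G_x,G_y$ be the matrices having $\{x_i\}_{i\in I}$, $\{y_i\}_{i\in I}$, $\{g^x_i\}_{i\in I}$, $\{g^y_i\}_{i\in I}$ as columns, respectively (in the same order). Then $A_I$ is $\mathcal{B}_L$-interpolable if and only if $$\begin{cases} f_i=\langle g^x_i,x_i\rangle=\langle g^y_i,y_i\rangle\quad \text{for all } i\in I,\\ G_x^\top X=Y^\top G_y,\\ G_x^\top G_x\preceq L^2\, Y^\top Y,\\ G_y^\top G_y\preceq L^2\, X^\top X.\end{cases}$$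
   Context: $\mathcal{B}_L$ is the set of functions $f:\mathbb{R}^{d_x}\times\mathbb{R}^{d_y}\to\mathbb{R}$ of the form $f(x,y)=y^\top A x$, where $A\in\mathbb{R}^{d_y\times d_x}$ has largest singular value $\sigma_{\max}(A)\leq L$. The data $A_I$ is $\mathcal{B}_L$-interpolable if there exists $f\in\mathcal{B}_L$ with $g^x_i=\nabla_x f(x_i,y_i)$, $g^y_i=\nabla_y f(x_i,y_i)$ and $f_i=f(x_i,y_i)$ for all $i\in I$. The symbol $\preceq$ denotes the Loewner order on symmetric matrices. *)

(* Defs.v *)
From HB Require Import structures.
From mathcomp Require Import all_boot all_order all_algebra.
From mathcomp Require Import all_classical all_reals all_analysis.

Set Implicit Arguments.
Unset Strict Implicit.
Unset Printing Implicit Defensive.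

Import Order.TTheory GRing.Theory Num.Theory.
Import numFieldNormedType.Exports.

Local Open Scope classical_set_scope.
Local Open Scope ring_scope.

Definition dot (R : realType) (d : nat) (u v : 'cV[R]_d) : R :=
  \sum_(k < d) u k 0 * v k 0.

(* The Euclidean gradient, as the vector of partial derivatives along the
   canonical basis. Like 'D_v, it is only meaningful where [h] is
   differentiable; it is applied below to (bi)linear functions only. *)
Definition gradient (R : realType) (d : nat) (h : 'cV[R]_d -> R)
    (p : 'cV[R]_d) : 'cV[R]_d :=
  \col_(k < d) 'D_(delta_mx k 0) h p.

Definition gradient_x (R : realType) (dx dy : nat)
    (f : 'cV[R]_dx * 'cV[R]_dy -> R) (x : 'cV[R]_dx) (y : 'cV[R]_dy) :
    'cV[R]_dx :=
  gradient (fun u => f (u, y)) x.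

Definition gradient_y (R : realType) (dx dy : nat)
    (f : 'cV[R]_dx * 'cV[R]_dy -> R) (x : 'cV[R]_dx) (y : 'cV[R]_dy) :
    'cV[R]_dy :=
  gradient (fun v => f (x, v)) y.

(* Square roots of the eigenvalues of A^T A. When A has more columns than rows
   this may add the value 0 to the usual list of min(m, n) singular values,
   which does not affect the largest one. *)
Definition singular_values (R : realType) (m n : nat) (A : 'M[R]_(m, n)) :
    set R :=
  [set Num.sqrt a | a in [set a : R | eigenvalue (A^T *m A) a]].

(* The set of singular values is finite, so this supremum is its maximum;
   it is 0 if n = 0. *)
Definition sigma_max (R : realType) (m n : nat) (A : 'M[R]_(m, n)) : R :=
  sup (singular_values A).

Definition bilinear_class (R : realType) (dx dy : nat) (L : R) :
    set ('cV[R]_dx * 'cV[R]_dy -> R) :=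
  [set f | exists2 A : 'M[R]_(dy, dx), sigma_max A <= L &
           forall x y, f (x, y) = (y^T *m A *m x) 0 0].

Definition interpolable (R : realType) (dx dy : nat) (I : finType)
    (F : set ('cV[R]_dx * 'cV[R]_dy -> R))
    (x : I -> 'cV[R]_dx) (y : I -> 'cV[R]_dy)
    (gx : I -> 'cV[R]_dx) (gy : I -> 'cV[R]_dy) (fv : I -> R) : Prop :=
  exists2 f, F f &
    forall i, [/\ gx i = gradient_x f (x i) (y i),
                  gy i = gradient_y f (x i) (y i) &
                  fv i = f (x i, y i)].

(* The columns are listed in the order of [enum I], whatever the family [u]. *)
Definition columns (R : realType) (d : nat) (I : finType)
    (u : I -> 'cV[R]_d) : 'M[R]_(d, #|I|) :=
  \matrix_(k < d, j < #|I|) u (enum_val j) k 0.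

Definition psdmx (R : realType) (n : nat) (M : 'M[R]_n) : Prop :=
  M^T = M /\ forall v : 'cV[R]_n, 0 <= (v^T *m M *m v) 0 0.

Definition loewner_le (R : realType) (n : nat) (M N : 'M[R]_n) : Prop :=
  psdmx (N - M).

(* Main.v *)
(* Interpolability means that a single matrix [A] with [|A| <= L] satisfies
   [A X = G_y] and [A^T Y = G_x]. By Douglas' factorization the two Gram
   inequalities give [S], [T] of norm at most [L] with [S X = G_y], [T Y = G_x],
   supported on the column spaces of [X] and [Y]; these prescribe [A P] and [Q A]
   for the orthogonal projections [P], [Q] onto those spaces, consistently because
   [G_x^T X = Y^T G_y]. Parrott's theorem fills in the remaining corner of [A]
   without increasing the norm. *)

Require Import Defs.
From HB Require Import structures.
From mathcomp Require Import all_boot all_order all_algebra.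
From mathcomp Require Import all_classical all_reals all_analysis.
From mathcomp Require Import ring lra.

Set Implicit Arguments.
Unset Strict Implicit.
Unset Printing Implicit Defensive.

Import Order.TTheory GRing.Theory Num.Theory.

Import numFieldNormedType.Exports.

Local Open Scope ring_scope.

(** * Euclidean inner product and Gram inequalities *)

Section DotProduct.
Context {R : realType}.

Lemma dot_mx d (u v : 'cV[R]_d) : dot u v = (u^T *m v) 0 0.
Proof. by rewrite mxE; apply: eq_bigr => k _; rewrite mxE. Qed.

Lemma dotC d (u v : 'cV[R]_d) : dot u v = dot v u.
Proof. by apply: eq_bigr => k _; rewrite mulrC. Qed.

Lemma dotDl d (u v w : 'cV[R]_d) : dot (u + v) w = dot u w + dot v w.
Proof. by rewrite -big_split; apply: eq_bigr => k _; rewrite mxE mulrDl. Qed.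

Lemma dotZl d a (u v : 'cV[R]_d) : dot (a *: u) v = a * dot u v.
Proof. by rewrite mulr_sumr; apply: eq_bigr => k _; rewrite mxE mulrA. Qed.

Lemma dotNl d (u v : 'cV[R]_d) : dot (- u) v = - dot u v.
Proof. by rewrite -scaleN1r dotZl mulN1r. Qed.

Lemma dotDr d (u v w : 'cV[R]_d) : dot u (v + w) = dot u v + dot u w.
Proof. by rewrite dotC dotDl !(dotC u). Qed.

Lemma dotZr d a (u v : 'cV[R]_d) : dot u (a *: v) = a * dot u v.
Proof. by rewrite dotC dotZl dotC. Qed.

Lemma dotNr d (u v : 'cV[R]_d) : dot u (- v) = - dot u v.
Proof. by rewrite dotC dotNl dotC. Qed.

Definition dotE := (dotDl, dotDr, dotNl, dotNr, dotZl, dotZr).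

Lemma dot_mull m n (A : 'M[R]_(m, n)) u v : dot (A *m u) v = dot u (A^T *m v).
Proof. by rewrite !dot_mx trmx_mul mulmxA. Qed.

Lemma dot_mulr m n (A : 'M[R]_(m, n)) u v : dot u (A *m v) = dot (A^T *m u) v.
Proof. by rewrite dot_mull trmxK. Qed.

Lemma dot0l d (u : 'cV[R]_d) : dot 0 u = 0.
Proof. by rewrite -(scale0r 0) dotZl mul0r. Qed.

Lemma dot0r d (u : 'cV[R]_d) : dot u 0 = 0.
Proof. by rewrite dotC dot0l. Qed.

Lemma dot_pythagoras d (u v : 'cV[R]_d) :
  dot u v = 0 -> dot (u + v) (u + v) = dot u u + dot v v.
Proof. by move=> uv; rewrite !dotE (dotC v u) uv addr0 add0r. Qed.

Lemma dot_ge0 d (u : 'cV[R]_d) : 0 <= dot u u.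
Proof. by apply: sumr_ge0 => k _; rewrite -expr2 sqr_ge0. Qed.

Lemma dot_eq0 d (u : 'cV[R]_d) : (dot u u == 0) = (u == 0).
Proof.
apply/eqP/eqP => [u0|->]; last by rewrite dot0l.
apply/colP => k; rewrite mxE; apply/eqP; rewrite -sqrf_eq0 expr2.
move/eqP: u0; rewrite psumr_eq0 => [|i _]; last by rewrite -expr2 sqr_ge0.
by move=> /allP/(_ k (mem_index_enum k)).
Qed.

Lemma dot_gt0 d (u : 'cV[R]_d) : (0 < dot u u) = (u != 0).
Proof. by rewrite lt_def dot_ge0 andbT dot_eq0. Qed.

(** The form of [c H^T H - G^T G] at [v] is [c |H v|^2 - |G v|^2], and its symmetry is automatic. *)
Lemma loewner_gramP p m n (G : 'M[R]_(p, n)) (H : 'M[R]_(m, n)) c :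
  loewner_le (G^T *m G) (c *: (H^T *m H)) <->
  forall v, dot (G *m v) (G *m v) <= c * dot (H *m v) (H *m v).
Proof.
have formE v : (v^T *m (c *: (H^T *m H) - G^T *m G) *m v) 0 0 =
    c * dot (H *m v) (H *m v) - dot (G *m v) (G *m v).
  rewrite !dot_mull !dot_mx mulmxBr mulmxBl -scalemxAr -scalemxAl !mulmxA.
  by rewrite [LHS]mxE [X in X + _]mxE [X in _ + X]mxE.
split=> [[_ h] v|h]; first by have := h v; rewrite formE subr_ge0.
split=> [|v]; last by rewrite formE subr_ge0.
by rewrite linearB linearZ /= !trmx_mul !trmxK.
Qed.

Lemma form_bounded m n (A : 'M[R]_(m, n)) :
  exists2 K : R, 0 < K & forall u, dot (A *m u) (A *m u) <= K * dot u u.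
Proof.
pose N := A^T *m A.
(* A crude constant from [|u_i u_j| <= |u|^2]; adding 1 makes it positive even when [A = 0]. *)
exists (\sum_i \sum_j `|N i j| + 1) => [|u].
  by rewrite ltr_wpDl //; do 2 apply: sumr_ge0 => ? _.
have sq_le k : u k 0 ^+ 2 <= dot u u.
  rewrite /dot (bigD1 k) //= -expr2 lerDl.
  by apply: sumr_ge0 => j _; rewrite -expr2 sqr_ge0.
have prod_le i j : `|u i 0 * u j 0| <= dot u u.
  have := sq_le i; have := sq_le j; have := sqr_ge0 (`|u i 0| - `|u j 0|).
  rewrite normrM -(real_normK (num_real (u i 0))) -(real_normK (num_real (u j 0))).
  nra.
rewrite mulrDl mul1r; apply: ler_wpDr; first exact: dot_ge0.
rewrite dot_mull mulmxA -/N {1}/dot mulr_suml; apply: ler_sum => i _.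
rewrite mxE mulr_sumr mulr_suml; apply: ler_sum => j _.
rewrite mulrCA (le_trans (ler_norm _)) // normrM.
by rewrite ler_wpM2l.
Qed.

End DotProduct.

(** * The largest singular value as an operator norm *)

Section OperatorNorm.
Context {R : realType}.
Local Open Scope classical_set_scope.

(* If [t] is optimal in [|A u|^2 <= t |u|^2] and [N = t - A^T A] were invertible,
   then [|u|^2 <= K |N u|^2 <= K (t + 1) <u, N u>] would allow a smaller [t]. *)
Lemma optimal_bound_eigenvalue m n (A : 'M[R]_(m, n)) (t : R) : 0 <= t ->
    (forall u, dot (A *m u) (A *m u) <= t * dot u u) ->
    (forall s, (forall u, dot (A *m u) (A *m u) <= s * dot u u) -> t <= s) ->
  eigenvalue (A^T *m A) t.
Proof.
move=> t0 tA tmin; pose N : 'M[R]_n := t%:M - A^T *m A.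
have trN : N^T = N by rewrite linearB /= tr_scalar_mx trmx_mul trmxK.
have NC u v : dot u (N *m v) = dot (N *m u) v by rewrite dot_mull trN.
have formN u : dot u (N *m u) = t * dot u u - dot (A *m u) (A *m u).
  by rewrite mulmxBl mul_scalar_mx !dotE -mulmxA -dot_mull.
apply: contraT; rewrite negbK /eigenspace kermx_eq0 row_free_unit -opprB -/N -scaleN1r.
rewrite unitmxZ ?unitrN1 // => Nu.
have [K K0 KN] := form_bounded (invmx N).
pose k := t + 1; have k0 : 0 < k by rewrite /k; lra.
(* Expand the form of [N >= 0] at [k u - N u], using [N <= k]. Taking [k = t + 1] instead of [t]
   allows division by [k] when [t = 0]. *)
have sqN u : dot (N *m u) (N *m u) <= k * dot u (N *m u).
  set w := N *m u.
  have : 0 <= dot (k *: u - w) (N *m (k *: u - w)) by rewrite formN subr_ge0.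
  have : dot w (N *m w) <= k * dot w w.
    by rewrite formN /k mulrDl mul1r; have := dot_ge0 (A *m w); have := dot_ge0 w; lra.
  rewrite mulmxBr -scalemxAr -/w !dotE (NC u w) -/w => w1 w2.
  have : 0 <= k * (k * dot u w - dot w w) by lra.
  by rewrite pmulr_rge0 // subr_ge0.
have Kk0 : 0 < K * k by rewrite mulr_gt0.
have /tmin : forall u, dot (A *m u) (A *m u) <= (t - (K * k)^-1) * dot u u.
  move=> u; rewrite mulrBl lerBrDr -lerBrDl -formN ler_pdivrMl //.
  rewrite -{1 2}[u](mulKmx Nu); apply: le_trans (KN _) _.
  by rewrite -mulrA ler_wpM2l // ltW.
by rewrite lerBrDr gerDl invr_le0 leNgt Kk0.
Qed.

(** Evaluating a bound at an eigenvector shows that it dominates every eigenvalue of [A^T A].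
    Conversely, the least valid constant is itself an eigenvalue, so its square root lies below the
    supremum. *)
Lemma sigma_max_leP m n (A : 'M[R]_(m, n)) (L : R) : 0 <= L ->
  sigma_max A <= L <-> forall u, dot (A *m u) (A *m u) <= L ^+ 2 * dot u u.
Proof.
move=> L0.
have eigen_le a K : eigenvalue (A^T *m A) a ->
    (forall u, dot (A *m u) (A *m u) <= K * dot u u) -> a <= K.
  (* [eigenvalue] provides a row eigenvector; symmetry of [A^T A] lets its transpose serve as a
     column one. *)
  move=> /eigenvalueP[v vA v0] /(_ v^T).
  rewrite dot_mull mulmxA -[A^T *m A]trmxK trmx_mul trmxK -trmx_mul vA.
  by rewrite linearZ /= dotZr ler_pM2r // dot_gt0 trmx_eq0.
split=> [sL u|AL]; last first.
  rewrite /sigma_max; have [->|/set0P S0] := eqVneq (singular_values A) set0.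
    by rewrite sup0.
  apply: ge_sup => // _ [a /= Aa <-].
  by rewrite -(ger0_norm L0) -sqrtr_sqr ler_wsqrtr // (eigen_le _ _ Aa).
have [K K0 KA] := form_bounded A.
pose E := [set t | forall v, dot (A *m v) (A *m v) <= t * dot v v].
have [->|u0] := eqVneq u 0; first by rewrite mulmx0 dot0l dot0l mulr0.
(* The nonzero [u] bounds [E] below; in dimension zero every real number would lie in [E]. *)
have E_ge0 t : E t -> 0 <= t.
  move=> /(_ u) /(le_trans (dot_ge0 _)).
  by rewrite pmulr_lge0 // dot_gt0.
have E0 : E !=set0 by exists K.
have infE : E (inf E).
  move=> v; have [->|v0] := eqVneq v 0.
    by rewrite mulmx0 dot0l dot0l mulr0.
  rewrite -ler_pdivrMr ?dot_gt0 //; apply: lb_le_inf => // t Et.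
  by rewrite ler_pdivrMr ?dot_gt0.
have lbE : has_lbound E by exists 0 => t /E_ge0.
have inf_eig : eigenvalue (A^T *m A) (inf E).
  apply: optimal_bound_eigenvalue => //; first exact: E_ge0.
  by move=> s Es; apply: ge_inf.
have : Num.sqrt (inf E) <= L.
  apply: le_trans sL; apply: ub_le_sup; last by exists (inf E).
  by exists (Num.sqrt K) => _ [a /= /eigen_le aK <-]; rewrite ler_wsqrtr // aK.
rewrite -(ler_pXn2r (n := 2)) ?nnegrE ?sqrtr_ge0 // sqr_sqrtr ?E_ge0 // => leL.
by apply: le_trans (infE u) _; rewrite ler_wpM2r ?dot_ge0.
Qed.

End OperatorNorm.

(** * Factorization, projections and norm-preserving completion *)

Section Completion.
Context {R : realType}.

(** The columns of [cokermx M] lie in the kernel of [M], so [V] kills them, which is row space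
    inclusion. *)
Lemma factor_ker m n p (M : 'M[R]_(m, n)) (V : 'M[R]_(p, n)) :
    (forall k : 'cV_n, M *m k = 0 -> V *m k = 0) ->
  exists Z, V = Z *m M.
Proof.
move=> kerMV; suff /submxP[Z ->] : (V <= M)%MS by exists Z.
rewrite submxE; apply/eqP/matrixP => i j.
have := kerMV (cokermx M *m delta_mx j 0).
rewrite (mulmxA M) (mulmxA V) mulmx_coker mul0mx -colE => /(_ erefl)/colP/(_ i).
by rewrite !mxE.
Qed.

(** Since [X^T X] and [X] have the same kernel, [X = Z X^T X] for some [Z], and [P = X Z^T] works:
    [X^T P = X^T] gives [P^T P = P^T], hence symmetry and idempotence. *)
Lemma orthogonal_projection m n (X : 'M[R]_(m, n)) :
  exists U : 'M[R]_(n, m), let P := X *m U in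
    [/\ P^T = P, P *m P = P & P *m X = X].
Proof.
have [Z XZ] : exists Z, X = Z *m (X^T *m X).
  apply: factor_ker => k Xk; apply/eqP; rewrite -dot_eq0.
  by rewrite dot_mull mulmxA Xk dot0r.
exists Z^T => P.
have XP : X^T *m P = X^T.
  by rewrite {2}XZ !trmx_mul trmxK mulmxA.
have PTP : P^T *m P = P^T by rewrite {1 3}/P !trmx_mul trmxK -mulmxA XP.
have trP : P^T = P.
  move: (P) PTP => P' P'TP'.
  by rewrite -[RHS]trmxK -P'TP' trmx_mul trmxK.
split=> //.
- by rewrite -{1}trP PTP.
- by apply: trmx_inj; rewrite trmx_mul trP.
Qed.

(* Parrott's theorem. With [B = Q S = T P], [C = T (1 - P)], [D = (1 - Q) S], the
   free corner of [A] is taken to be [- D (L^2 - B^T B)^+ B^T C]; only a solution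
   [Z] of [C^T B = Z (L^2 - B^T B)] is needed, not a pseudo-inverse. *)
Lemma contractive_completion m n (P : 'M[R]_n) (Q : 'M[R]_m)
    (S T : 'M[R]_(m, n)) (L : R) :
    0 < L -> P^T = P -> P *m P = P -> Q^T = Q -> Q *m Q = Q ->
    S *m P = S -> Q *m T = T -> T *m P = Q *m S ->
    (forall u, dot (S *m u) (S *m u) <= L ^+ 2 * dot u u) ->
    (forall v, dot (T^T *m v) (T^T *m v) <= L ^+ 2 * dot v v) ->
  exists A : 'M[R]_(m, n), [/\ A *m P = S, Q *m A = T &
    forall u, dot (A *m u) (A *m u) <= L ^+ 2 * dot u u].
Proof.
move=> L0 trP PP trQ QQ SP QT TP_QS.
move: (L ^+ 2) (exprn_gt0 2 L0) => l l0 leS leT.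
pose B := Q *m S; pose C := T - B; pose D := S - B.
have BP : B *m P = B by rewrite -mulmxA SP.
have QB : Q *m B = B by rewrite mulmxA QQ.
have CP : C *m P = 0 by rewrite mulmxBl TP_QS BP subrr.
have QC : Q *m C = C by rewrite mulmxBr QT QB.
have QD : Q *m D = 0 by rewrite mulmxBr QB subrr.
have DP : D *m P = D by rewrite mulmxBl SP BP.
(* [B^T] and [C^T] have orthogonal ranges, so the left side is [|T^T h|^2]; in [leD] it is [|S r|^2]
   for the same reason. *)
have leC h : dot (B^T *m h) (B^T *m h) + dot (C^T *m h) (C^T *m h) <= l * dot h h.
  rewrite -dot_pythagoras -?mulmxDl -?linearD /= 1?addrC ?subrK //.
  rewrite dot_mull trmxK -BP mulmxA -(mulmxA B) -{1}trP -trmx_mul CP.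
  by rewrite trmx0 mulmx0 mul0mx dot0r.
have leD r : dot (B *m r) (B *m r) + dot (D *m r) (D *m r) <= l * dot r r.
  rewrite -dot_pythagoras -?mulmxDl 1?addrC ?subrK //.
  by rewrite -QB -mulmxA dot_mull trQ mulmxA QD mul0mx dot0r.
(* If [B^T B k = l k], then [|B^T B k|^2] already equals [l |B k|^2], and [leC] at [B k] forces
   [C^T B k = 0]. *)
have [Z CBZ] : exists Z, C^T *m B = Z *m (l%:M - B^T *m B).
  apply: factor_ker => k; rewrite mulmxBl mul_scalar_mx => /subr0_eq lk.
  apply/eqP; rewrite -dot_eq0 eq_le dot_ge0 andbT -mulmxA.
  have := leC (B *m k); rewrite (mulmxA B^T) -lk [X in _ <= l * X]dot_mull.
  by rewrite (mulmxA B^T) -lk !dotE; lra.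
(* The factor [1 - P] makes the corner [- D E] vanish on the range of [P], so that [A P = S]
   survives. *)
pose E := Z^T *m (1%:M - P).
have ME : (l%:M - B^T *m B) *m E = B^T *m C.
  have trM : (l%:M - B^T *m B)^T = l%:M - B^T *m B.
    by rewrite linearB /= tr_scalar_mx trmx_mul trmxK.
  rewrite mulmxA -[in LHS]trM -trmx_mul -CBZ trmx_mul trmxK mulmxBr mulmx1.
  by rewrite -[X in _ - X]mulmxA CP mulmx0 subr0.
have EP : E *m P = 0 by rewrite -mulmxA mulmxBl mul1mx PP subrr mulmx0.
exists (S + C - D *m E); split=> [||a].
- by rewrite mulmxBl mulmxDl SP CP -mulmxA EP mulmx0 addr0 subr0.
- by rewrite mulmxBr mulmxDr QC mulmxA QD mul0mx subr0 addrC subrK.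
pose u := P *m a; pose v := a - u; pose w := E *m a; pose z := C *m a.
have zv : z = C *m v by rewrite mulmxBr mulmxA CP mul0mx subr0.
have Bz : B^T *m z = l *: w - B^T *m (B *m w).
  by rewrite /z (mulmxA B^T C) -ME -mulmxA mulmxBl mul_scalar_mx mulmxA.
have uBz : dot (B *m u) z = l * dot u w - dot (B *m u) (B *m w).
  by rewrite dot_mull Bz !dotE -dot_mull.
have wBz : dot (B *m w) z = l * dot w w - dot (B *m w) (B *m w).
  by rewrite dot_mull Bz !dotE -dot_mull.
(* The two summands lie in the range of [Q] and in its orthogonal complement, so their squared norms
   add. *)
have -> : (S + C - D *m E) *m a = (B *m u + z) + D *m (u - w).
  have Sa : S *m a = B *m u + D *m u.
    by rewrite /u !mulmxA BP DP -mulmxDl [B + D]addrC subrK.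
  by rewrite mulmxBl mulmxDl mulmxBr Sa -(mulmxA D) -/z -/w addrA (addrAC (B *m u)).
have aE : dot a a = dot u u + dot v v.
  rewrite -dot_pythagoras; first by rewrite addrC subrK.
  by rewrite dot_mull trP mulmxBr [P *m u]mulmxA PP subrr dot0r.
rewrite aE dot_pythagoras; last first.
  have -> : B *m u + z = Q *m (B *m u + z).
    by rewrite mulmxDr /z (mulmxA Q B u) (mulmxA Q C a) QB QC.
  by rewrite dot_mull trQ mulmxA QD mul0mx dot0r.
(* This [h] satisfies [B^T h = l w]. Then [leC] at [h] bounds [|C^T h|^2] by [l <v, C^T h>], and
   [|l v - C^T h|^2 >= 0] yields [le_lv]. *)
clearbody u v w z; pose h := z + B *m w.
have BTh : B^T *m h = l *: w by rewrite mulmxDr Bz subrK.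
have vCh : dot v (C^T *m h) = dot z z + dot (B *m w) z.
  by rewrite -dot_mull -zv dotDr [dot z (B *m w)]dotC.
have le_lv : dot z z + dot (B *m w) z <= l * dot v v.
  have := dot_ge0 (l *: v - C^T *m h); have := leC h.
  rewrite BTh !dotE (dotC _ v) vCh [dot z (B *m w)]dotC => h1 h2.
  have : 0 <= l * (l * dot v v - (dot z z + dot (B *m w) z)).
    move: h1 h2; rewrite wBz; nra.
  by rewrite pmulr_rge0 // subr_ge0.
(* Bounding the [D] part by [leD], the cross terms cancel through [uBz]; what remains is
   [l |u|^2 + |z|^2 + <B w, z>], which [le_lv] controls. *)
have := leD (u - w); move: le_lv.
rewrite mulmxBr !dotE [dot z (B *m u)]dotC uBz wBz.
rewrite (dotC w u) (dotC (B *m w) (B *m u)); lra.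
Qed.

End Completion.

(** * From gradients to matrix equations and their solvability *)

Section Interpolation.
Context {R : realType}.
Local Open Scope classical_set_scope.

Lemma gradient_dot d (c p : 'cV[R]_d) : gradient (dot c) p = c.
Proof.
apply/colP => k; rewrite mxE /derive.
rewrite (_ : c k 0 = dot c (delta_mx k 0)); last first.
  rewrite /dot (bigD1 k) //= big1 ?mxE ?eqxx ?mulr1 ?addr0 // => j /negPf jk.
  by rewrite mxE jk mulr0.
(* By linearity the difference quotient is constant away from [h = 0]. *)
apply: cvg_lim => //; apply: cvg_near_cst; near=> h.
have h0 : h != 0 by near: h; exact: nbhs_dnbhs_neq.
by rewrite /= dotDr dotZr addrK scalerA mulVf // scale1r.
Unshelve. all: by end_near. Qed.

Lemma columns_mulmx d e (I : finType) (A : 'M[R]_(e, d))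
    (u : I -> 'cV[R]_d) (w : I -> 'cV[R]_e) :
  (forall i, w i = A *m u i) <-> columns w = A *m columns u.
Proof.
split=> [wE|AE i]; last first.
  apply/colP => k; move/matrixP/(_ k (enum_rank i)): AE.
  by rewrite !mxE enum_rankK => ->; apply: eq_bigr => j _; rewrite mxE enum_rankK.
by apply/matrixP => k j; rewrite !mxE wE mxE; apply: eq_bigr => l _; rewrite mxE.
Qed.

Lemma gradient_bilinear dx dy (A : 'M[R]_(dy, dx)) f :
    (forall x y, f (x, y) = (y^T *m A *m x) 0 0) -> forall x y,
  [/\ f (x, y) = dot y (A *m x), gradient_x f x y = A^T *m y &
      gradient_y f x y = A *m x].
Proof.
move=> fA x y; have fE u v : f (u, v) = dot v (A *m u).
  by rewrite fA dot_mx mulmxA.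
split=> //.
- rewrite -[RHS](gradient_dot _ x); congr gradient; apply/funext => u.
  by rewrite fE dot_mulr.
- rewrite -[RHS](gradient_dot _ y); congr gradient; apply/funext => v.
  by rewrite fE dotC.
Qed.

(** For [c > 0], combine [|c v - A A^T v|^2 >= 0] with the bound at [A^T v] and divide by [c]. *)
Lemma norm_bound_trmx m n (A : 'M[R]_(m, n)) (c : R) : 0 <= c ->
    (forall u, dot (A *m u) (A *m u) <= c * dot u u) ->
  forall v, dot (A^T *m v) (A^T *m v) <= c * dot v v.
Proof.
rewrite le_eqVlt => /predU1P[<- A0 v|c0 leA v].
  have : A *m (A^T *m v) = 0.
    apply/eqP; rewrite -dot_eq0 eq_le dot_ge0 andbT.
    by rewrite (le_trans (A0 _)) ?mul0r.
  by rewrite mul0r dot_mull trmxK => ->; rewrite dot0r.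
have := dot_ge0 (c *: v - A *m (A^T *m v)); have := leA (A^T *m v).
rewrite !dotE (dotC (A *m _) v) (dot_mulr A v) => h1 h2.
have : 0 <= c * (c * dot v v - dot (A^T *m v) (A^T *m v)) by nra.
by rewrite pmulr_rge0 // subr_ge0.
Qed.

(** Douglas' factorization. Composing a solution of [G = S X] with [P = X U] gives [|S P u|^2 = |G U
    u|^2 <= c |P u|^2 <= c |u|^2]. The factor [U] is exported to check the compatibility of two such
    solutions. *)
Lemma factor_bounded m n p (G : 'M[R]_(p, n)) (X : 'M[R]_(m, n)) (c : R) : 0 <= c ->
    (forall k, dot (G *m k) (G *m k) <= c * dot (X *m k) (X *m k)) ->
  exists P : 'M[R]_m, exists U : 'M[R]_(n, m), exists S : 'M[R]_(p, m),
    [/\ P^T = P, P *m P = P, P = X *m U &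
    [/\ P *m X = X, S *m P = S, S *m X = G &
        forall u, dot (S *m u) (S *m u) <= c * dot u u]].
Proof.
move=> c0 leG; have [U [trP PP PX]] := orthogonal_projection X.
have [S SX] : exists S, G = S *m X.
  apply: factor_ker => k Xk; apply/eqP; rewrite -dot_eq0 eq_le dot_ge0 andbT.
  by rewrite (le_trans (leG k)) // Xk dot0l mulr0.
exists (X *m U), U, (S *m (X *m U)); split=> //; split=> //.
- by rewrite -mulmxA PP.
- by rewrite -mulmxA PX -SX.
move=> u; rewrite mulmxA -SX -mulmxA (le_trans (leG _)) // ler_wpM2l //.
rewrite mulmxA; set P := X *m U.
have := dot_ge0 (u - P *m u).
have -> : dot (u - P *m u) (u - P *m u) = dot u u - dot (P *m u) (P *m u).
  have PuPu : dot (P *m u) (P *m u) = dot u (P *m u).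
    by rewrite dot_mull trP mulmxA PP.
  by rewrite !dotE (dotC (P *m u) u) PuPu; lra.
by rewrite subr_ge0.
Qed.

Lemma bounded_interpolation m n k (L : R) (X Gx : 'M[R]_(n, k))
    (Y Gy : 'M[R]_(m, k)) : 0 <= L -> Gx^T *m X = Y^T *m Gy ->
    (forall v, dot (Gx *m v) (Gx *m v) <= L ^+ 2 * dot (Y *m v) (Y *m v)) ->
    (forall v, dot (Gy *m v) (Gy *m v) <= L ^+ 2 * dot (X *m v) (X *m v)) ->
  exists A : 'M[R]_(m, n), [/\ A *m X = Gy, A^T *m Y = Gx &
    forall u, dot (A *m u) (A *m u) <= L ^+ 2 * dot u u].
Proof.
rewrite le_eqVlt => /predU1P[<-|L0] GXY leGx leGy.
  (* Completion requires [L > 0]; for [L = 0] both gradient matrices vanish and [A = 0] works. *)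
  have G0 p q (G : 'M[R]_(p, k)) (H : 'M[R]_(q, k)) :
      (forall v, dot (G *m v) (G *m v) <= 0 ^+ 2 * dot (H *m v) (H *m v)) -> G = 0.
    move=> leG; suff [Z ->] : exists Z, G = Z *m (0 : 'M[R]_(p, k)) by rewrite mulmx0.
    apply: factor_ker => v _; apply/eqP; rewrite -dot_eq0 eq_le dot_ge0 andbT.
    by rewrite (le_trans (leG v)) // expr0n mul0r.
  exists 0; split; rewrite ?trmx0 ?mul0mx.
  - by rewrite (G0 _ _ _ _ leGy).
  - by rewrite (G0 _ _ _ _ leGx).
  - by move=> u; rewrite mul0mx dot0l expr0n mul0r.
have [P [U [S [trP PP PE [PX SP SX leS]]]]] := factor_bounded (sqr_ge0 L) leGy.
have [Q [V [T [trQ QQ QE [QY TQ TY leT]]]]] := factor_bounded (sqr_ge0 L) leGx.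
have [||||A [AP QA leA]] := contractive_completion (T := T^T) L0 trP PP trQ QQ SP.
- by rewrite -{1}trQ -trmx_mul TQ.
(* Compatibility on the overlap: [T^T P = V^T Gx^T X U] and [Q S = V^T Y^T Gy U], equal by [GXY]. *)
- have QV : Q = V^T *m Y^T by rewrite -trmx_mul -QE trQ.
  have -> : T^T *m P = V^T *m (Gx^T *m X) *m U.
    by rewrite -{1}TQ trmx_mul trQ QV -TY trmx_mul PE !mulmxA.
  by rewrite GXY -SP PE (mulmxA S) SX QV !mulmxA.
- exact: leS.
- by move=> v; rewrite trmxK.
exists A; split=> //.
- by rewrite -PX mulmxA AP.
- by rewrite -QY mulmxA -{1}trQ -trmx_mul QA trmxK.
Qed.

(** This removes gradients and singular values: [y^T A x] has gradients [A^T y] and [A x], and its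
    value is [<A x, y>]. *)
Lemma interpolable_bilinearP (dx dy : nat) (L : R) (I : finType)
    (x : I -> 'cV[R]_dx) (y : I -> 'cV[R]_dy)
    (gx : I -> 'cV[R]_dx) (gy : I -> 'cV[R]_dy) (f : I -> R) : 0 <= L ->
  interpolable (bilinear_class L) x y gx gy f <->
  exists A : 'M[R]_(dy, dx),
    [/\ forall u, dot (A *m u) (A *m u) <= L ^+ 2 * dot u u,
        columns gy = A *m columns x, columns gx = A^T *m columns y &
        forall i, f i = dot (gy i) (y i)].
Proof.
move=> L0; split=> [[h [A /(sigma_max_leP _ L0) leA hA] hi]|[A [leA gyE gxE fE]]].
  have E i : [/\ gy i = A *m x i, gx i = A^T *m y i & f i = dot (gy i) (y i)].
    have [-> -> ->] := hi i; have [-> -> ->] := gradient_bilinear hA (x i) (y i).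
    by rewrite dotC.
  exists A; split=> // [||i]; [apply/columns_mulmx => i..|]; by have [] := E i.
pose h (p : 'cV[R]_dx * 'cV[R]_dy) := (p.2^T *m A *m p.1) 0 0.
have hA u v : h (u, v) = (v^T *m A *m u) 0 0 by [].
exists h; first by exists A => //; apply/(sigma_max_leP _ L0).
move=> i; have [-> -> ->] := gradient_bilinear hA (x i) (y i).
move/columns_mulmx in gyE; move/columns_mulmx in gxE.
by split; rewrite ?fE ?gxE ?gyE // dotC.
Qed.

End Interpolation.

Theorem theorem3p14 (R : realType) (dx dy : nat) (L : R) (hL : 0 <= L)
    (I : finType) (hI : (0 < #|I|)%N)
    (x : I -> 'cV[R]_dx) (y : I -> 'cV[R]_dy)
    (gx : I -> 'cV[R]_dx) (gy : I -> 'cV[R]_dy) (f : I -> R) :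
  let X := columns x in
  let Y := columns y in
  let Gx := columns gx in
  let Gy := columns gy in
  interpolable (bilinear_class L) x y gx gy f <->
  [/\ forall i : I, f i = dot (gx i) (x i) /\ dot (gx i) (x i) = dot (gy i) (y i),
      Gx^T *m X = Y^T *m Gy,
      loewner_le (Gx^T *m Gx) (L ^+ 2 *: (Y^T *m Y)) &
      loewner_le (Gy^T *m Gy) (L ^+ 2 *: (X^T *m X))].
Proof.
move=> X Y Gx Gy; split=> [/(interpolable_bilinearP _ _ _ _ _ hL)|].
  move=> [A [leA GyE GxE fE]]; split.
  - move=> i; have gxE := (columns_mulmx _ _ _).2 GxE i.
    have gyE := (columns_mulmx _ _ _).2 GyE i.
    suff e : dot (gx i) (x i) = dot (gy i) (y i) by rewrite e fE.
    by rewrite gxE gyE dot_mull trmxK dotC.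
  - by rewrite /Gx GxE /Gy GyE trmx_mul trmxK mulmxA.
  - apply/loewner_gramP => v; rewrite /Gx GxE -mulmxA.
    (* Here the bound is needed for [A^T], since [Gx = A^T Y]. *)
    exact: norm_bound_trmx (sqr_ge0 L) leA _.
  - by apply/loewner_gramP => v; rewrite /Gy GyE -mulmxA.
move=> [fE GXY /loewner_gramP leGx /loewner_gramP leGy].
have [A [AX AY leA]] := bounded_interpolation hL GXY leGx leGy.
apply/(interpolable_bilinearP _ _ _ _ _ hL); exists A; split=> // i.
by have [-> ->] := fE i.
Qed.
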